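(* Let $d\in\mathbb{N}$, $p\in[-\infty,1)$, $q\in\mathbb{N}_0$ and let $0\le k_0<k_1<\dots<k_q\le d$ be integers. Let $K=K_{k_0,\dots,k_q}\in\mathbb{R}^{(d+1)^2\times s}$, $s=\sum_{\ell=0}^q(2k_\ell+1)$, be the selection matrix for which $K^Tc$ is the vector of coefficients $\{c_{k_\ell}^m: m=-k_\ell,\dots,k_\ell;\ \ell=0,\dots,q\}$. Then the uniform distribution on the sphere, $$\xi^*(d\theta,d\phi)=\frac{1}{4\pi}\sin\theta\,d\theta\,d\phi \quad\text{on } [0,\pi]\times(-\pi,\pi],$$ is a $\Phi_p$-optimal design for estimating $K^Tc$ in the spherical harmonic regression model of degree $d$. Moreover, the information matrix of $\xi^*$ in this model is $M(\xi^* )=I_{(d+1)^2}$.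
   Context: Spherical harmonic functions: for $n\in\mathbb{N}_0$, $Y_n^0(\theta,\phi)=\sqrt{2n+1}\,P_n(\cos\theta)$ with $P_n$ the $n$-th Legendre polynomial; for $1\le m\le n$, $Y_n^m(\theta,\phi)=\sqrt{2(2n+1)\frac{(n-m)!}{(n+m)!}}\,P_n^m(\cos\theta)\cos(m\phi)$ and $Y_n^{-m}(\theta,\phi)=\sqrt{2(2n+1)\frac{(n-m)!}{(n+m)!}}\,P_n^m(\cos\theta)\sin(m\phi)$, where $P_n^m(x)=(-1)^m(1-x^2)^{m/2}\frac{d^m}{dx^m}P_n(x)$ is the associated Legendre function; these functions are orthonormal with respect to $\frac{1}{4\pi}\sin\theta\,d\theta\,d\phi$ on $[0,\pi]\times(-\pi,\pi]$. The spherical harmonic regression model of degree $d$ is $E[Y\mid\theta,\phi]=c^Tf_d(\theta,\phi)$, $\mathrm{Var}[Y\mid\theta,\phi]=\sigma^2>0$, with $f_d=(Y_0^0,Y_1^{-1},Y_1^0,Y_1^1,\dots,Y_d^{-d},\dots,Y_d^d)^T\in\mathbb{R}^{(d+1)^2}$ and $c=(c_0^0,c_1^{-1},c_1^0,c_1^1,\dots,c_d^{-d},\dots,c_d^d)^T$. A design is a probability measure $\xi$ on $[0,\pi]\times(-\pi,\pi]$; its information matrix is $M(\xi)=\int f_d f_d^T\,d\xi$. For a matrix $K$ of rank $s$, $K^Tc$ is estimable under $\xi$ if $\mathrm{range}(K)\subset\mathrm{range}(M(\xi))$; for such $\xi$ set $C_K(\xi)=(K^TM^-(\xi)K)^{-1}$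 ($M^-$ a generalized inverse) and $\Phi_p(\xi)=(\mathrm{tr}\,C_K(\xi)^{p})^{1/p}$ for $p\in(-\infty,1)\setminus\{0\}$, $\Phi_0(\xi)=\det C_K(\xi)$, $\Phi_{-\infty}(\xi)=\lambda_{\min}(C_K(\xi))$. A design is $\Phi_p$-optimal for estimating $K^Tc$ if it maximizes $\Phi_p$ among all designs under which $K^Tc$ is estimable. *)

(* Defs.v *)
From HB Require Import structures.
From mathcomp Require Import all_boot all_order all_algebra.
From mathcomp Require Import all_classical all_reals all_analysis.
Set Implicit Arguments. Unset Strict Implicit. Unset Printing Implicit Defensive.
Import Order.TTheory GRing.Theory Num.Theory.
Import numFieldNormedType.Exports.
Local Open Scope classical_set_scope.
Local Open Scope ring_scope.

Section SphHarm.
Variable R : realType.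

(* Legendre polynomial via Rodrigues' formula:
   P_n = 1/(2^n n!) (d/dx)^n (x^2 - 1)^n *)
Definition legendre (n : nat) : {poly R} :=
  ((2 ^ n * n`!)%:R)^-1 *: ((('X ^+ 2 - 1) ^+ n)^`(n)).

Definition assoc_legendre (n m : nat) (x : R) : R :=
  (-1) ^+ m * Num.sqrt (1 - x ^+ 2) ^+ m * ((legendre n)^`(m)).[x].

Definition sph_harm (n : nat) (m : int) (t : R * R) : R :=
  let a := `|m|%N in
  if m == 0 then Num.sqrt (2 * n + 1)%:R * (legendre n).[cos t.1]
  else Num.sqrt (2 * (2 * n + 1)%:R * (n - a)`!%:R / (n + a)`!%:R)
       * assoc_legendre n a (cos t.1)
       * (if (0 < m)%R then cos (a%:R * t.2) else sin (a%:R * t.2)).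

(* decoding of the index i of f_d (ordering Y_0^0, Y_1^-1, Y_1^0, Y_1^1, ...):
   i = n^2 + n + m *)
Definition hdeg (i : nat) : nat := (\max_(j < i.+1 | j * j <= i) j)%N.
Definition hord (i : nat) : int := i%:Z - (hdeg i * hdeg i + hdeg i)%N%:Z.

Definition fvec (d : nat) (t : R * R) : 'cV[R]_((d.+1) ^ 2) :=
  \col_i sph_harm (hdeg i) (hord i) t.

Definition dspace : set (R * R) := `[0, pi] `*` `]- pi, pi].

Definition is_design (xi : probability (R * R)%type R) : Prop :=
  xi dspace = 1%E.

Definition info_mx (d : nat) (xi : probability (R * R)%type R)
  : 'M[R]_((d.+1) ^ 2) :=
  \matrix_(i, j) Rintegral xi dspace (fun t => fvec d t i ord0 * fvec d t j ord0).

Definition sel_set (d q : nat) (k : 'I_q.+1 -> nat) : {set 'I_((d.+1) ^ 2)} :=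
  [set i : 'I_((d.+1) ^ 2) | [exists l, hdeg i == k l]].

Definition sel_mx (d q : nat) (k : 'I_q.+1 -> nat)
  : 'M[R]_((d.+1) ^ 2, #|@sel_set d q k|) :=
  \matrix_(i, j) (i == enum_val j)%:R.

(* range(K) \subset range(M) : column spaces *)
Definition estimable (n s : nat) (K : 'M[R]_(n, s)) (M : 'M[R]_n) : bool :=
  (K^T <= M^T)%MS.

(* C_K(xi) = (K^T M^- K)^{-1}; pinvmx M is a generalized inverse
   (M *m pinvmx M *m M = M) *)
Definition CK (n s : nat) (K : 'M[R]_(n, s)) (M : 'M[R]_n) : 'M[R]_s :=
  invmx (K^T *m pinvmx M *m K).

(* the eigenvalues (with multiplicity) of a square matrix whose characteristic
   polynomial splits over R (e.g. symmetric matrices) *)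
Definition eigs (s : nat) (C : 'M[R]_s) : seq R :=
  xget [::] [set l : seq R | char_poly C = \prod_(x <- l) ('X - x%:P)].

(* Phi_p of a positive definite matrix C:
   p = -oo : lambda_min(C); p = 0 : det C; otherwise (tr C^p)^(1/p) where
   tr C^p = sum of lambda^p over the eigenvalues of C *)
Definition Phi_mx (p : \bar R) (s : nat) (C : 'M[R]_s) : R :=
  match p with
  | -oo%E => \big[Num.min/head 0 (eigs C)]_(x <- eigs C) x
  | r%:E => if r == 0 then \det C
            else (\sum_(x <- eigs C) x `^ r) `^ (r^-1)
  | +oo%E => 0
  end.

Definition Phi_p (p : \bar R) (n s : nat) (K : 'M[R]_(n, s)) (M : 'M[R]_n) : R :=
  Phi_mx p (CK K M).

Definition is_uniform_sphere (xi : probability (R * R)%type R) : Prop :=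
  forall A : set (R * R), measurable A ->
    xi A = (\int[(@lebesgue_measure R) \x (@lebesgue_measure R)]_(t in A `&` dspace)
              (sin t.1 / (4 * pi))%:E)%E.

End SphHarm.

Arguments sel_mx R d {q} k.
Arguments info_mx {R} d xi.

(* Main.v *)
(* Idea. By the addition theorem, sum_m (Y_n^m)^2 = 2n+1 pointwise, so tr (K^T M(xi) K) = s for
   every design xi. Estimability gives K = M W, hence C_K = (W^T M W)^-1, and K^T M K - C_K = Z^T M Z with
   Z = W C_K - K; therefore tr C_K <= s. As C_K is positive definite, the tangent line of x |-> x^p
   (or ln) at x = 1 turns this trace bound into Phi_p(C_K) <= Phi_p(I_s), and I_s = C_K(xi^* ).
   The addition theorem and the normalisation of the Legendre functions both come from the Legendre
   equation: it makes the derivative of the sum of squares telescope to 0, and it gives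
   int (1-x^2)^(m+1) P_n^(m+1) P_l^(m+1) = (n+m+1)(n-m) int (1-x^2)^m P_n^(m) P_l^(m);
   integrating the addition theorem then yields int P_n^2 = 2/(2n+1). *)
Require Import Defs.
From HB Require Import structures.
From mathcomp Require Import all_boot all_order all_algebra.
From mathcomp Require Import all_classical all_reals all_analysis.
From mathcomp Require Import measurable_realfun lebesgue_integral_fubini.
From mathcomp Require Import zify ring lra.
Import Order.TTheory GRing.Theory Num.Theory.
Import numFieldNormedType.Exports.
Local Open Scope classical_set_scope.
Local Open Scope ring_scope.

(** * Legendre polynomials *)

Lemma deriv_natr (R : nzRingType) (k : nat) : (k%:R : {poly R})^`() = 0.
Proof. by rewrite -polyC_natr derivC. Qed.

Lemma derivn_derivn (R : nzSemiRingType) (p : {poly R}) (m n : nat) :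
  p^`(n)^`(m) = p^`(m + n).
Proof. by rewrite /derivn iterD. Qed.

Lemma deriv_eq0P (R : numDomainType) (p : {poly R}) : p^`() = 0 -> p = (p.[0])%:P.
Proof.
move=> dp; apply/polyP => -[|i]; rewrite coefC /= -?horner_coef0 //.
have := coef_deriv p i; rewrite dp coef0 => /esym/eqP.
by rewrite mulrn_eq0 /= => /eqP.
Qed.

(** Differentiating (x^2-1) u' = 2 n x u once gives the case j = 0, and each further differentiation
    raises j by one. *)
Lemma derivn_sqrX_sub1_exp (R : comNzRingType) (n j : nat) :
  let u := ('X ^+ 2 - 1) ^+ n : {poly R} in
  ('X ^+ 2 - 1) * u^`(j.+2) + 2 * (j.+1%:R - n%:R) * 'X * u^`(j.+1)
    + j.+1%:R * (j%:R - 2 * n%:R) * u^`(j) = 0.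
Proof.
move=> u; rewrite {}/u; set W := 'X ^+ 2 - 1.
have dW : W^`() = 2 * 'X.
  by rewrite derivB derivXn -polyC1 derivC subr0 -mulr_natl.
have d1 : W * (W ^+ n)^`() = 2 * n%:R * 'X * W ^+ n.
  rewrite deriv_exp dW; case: n => [|n]; first by rewrite mulr0n; ring.
  by rewrite [W ^+ n.+1]exprS -mulr_natl /=; ring.
move: (W ^+ n) d1 => u d1; clearbody W; elim: j => [|j IH].
  rewrite derivn0 !derivSn !derivn0.
  have /(congr1 (@deriv R)) := d1.
  rewrite !(deriv_natr, derivM, derivX) dW.
  by move=> /eqP; rewrite -subr_eq0 => /eqP H; rewrite -[RHS]H; ring.
have /(congr1 (@deriv R)) := IH.
rewrite !(deriv_natr, derivM, derivB, derivD, derivX) dW deriv0 -!derivnS.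
by move=> H; rewrite -[RHS]H; ring.
Qed.

(* In the Leibniz expansion only the term in which every factor 'X - a is differentiated
   survives at a. *)
Lemma derivn_XsubC_exp_horner (R : comNzRingType) (a : R) (n : nat) (q : {poly R}) :
  ((('X - a%:P) ^+ n * q)^`(n)).[a] = n`!%:R * q.[a].
Proof.
elim: n q => [|n IH] q; first by rewrite expr0 mul1r derivn0 fact0 mul1r.
rewrite derivSn derivM deriv_exp derivXsubC mul1r [n.+1.-1]/=.
rewrite -mulr_natr exprS.
have -> : ('X - a%:P) ^+ n * n.+1%:R * q + ('X - a%:P) * ('X - a%:P) ^+ n * q^`()
  = ('X - a%:P) ^+ n * (n.+1%:R * q + ('X - a%:P) * q^`()) by ring.
rewrite IH !hornerE subrr mul0r addr0 factS natrM.
by rewrite -polyC_natr hornerC; ring.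
Qed.

Section Legendre.
Variable R : realType.
Implicit Types n m l : nat.
Local Notation P := (legendre R).

(** Case j = m + n of the recurrence for (x^2-1)^n: the coefficients become 2(m+1) and (m+n+1)(m-n)
    = m(m+1) - n(n+1). *)
Lemma legendre_ode n m :
  (1 - 'X ^+ 2) * (P n)^`(m.+2) = 2 * m.+1%:R * 'X * (P n)^`(m.+1)
    - (n%:R * n.+1%:R - m%:R * m.+1%:R) * (P n)^`(m).
Proof.
rewrite /legendre !derivnZ !derivn_derivn !addSn.
have H := derivn_sqrX_sub1_exp R n (m + n); cbv zeta in H; move: H.
move: (_^`((m + n).+2)) => u2; move: (_^`((m + n).+1)) => u1; move: (_^`(m + n)) => u0.
move: (_^-1) => c H.
rewrite -!mul_polyC; apply/eqP; rewrite -subr_eq0 -(mulr0 (- c%:P)) -H.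
by apply/eqP; ring.
Qed.

Lemma legendre1 n : (P n).[1] = 1.
Proof.
rewrite /legendre hornerZ.
have -> : ('X ^+ 2 - 1 : {poly R}) ^+ n = ('X - 1%:P) ^+ n * ('X + 1) ^+ n.
  by rewrite -exprMn; congr (_ ^+ _); rewrite polyC1; ring.
rewrite derivn_XsubC_exp_horner horner_exp !hornerE -[1 + 1]/(2%:R) -natrX /= -mulrA -natrM mulnC.
by rewrite mulVf // pnatr_eq0 muln_eq0 expn_eq0 negb_or /= -lt0n fact_gt0.
Qed.

Lemma derivn_legendre_eq0 n : (P n)^`(n.+1) = 0.
Proof.
rewrite /legendre derivnZ derivn_derivn derivn_poly0 ?scaler0 //.
apply: leq_trans (size_poly_exp_leq _ _) _.
have -> : size ('X ^+ 2 - 1 : {poly R}) = 3 by rewrite -polyC1 size_XnsubC.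
by rewrite /= addSn ltnS addnn -mul2n.
Qed.

(** The extra factor is (n-m)(n+m+1), which is also the coefficient in the Legendre equation; this
    agreement drives both the telescoping and the normalisation below. *)
Lemma natr_fact_ratio n m : (m < n)%N -> ((n - m)`!%:R / (n + m)`!%:R : R) =
  (n - m.+1)`!%:R / (n + m.+1)`!%:R * (n%:R * n.+1%:R - m%:R * m.+1%:R).
Proof.
move=> lmn; rewrite -(subnSK lmn) addnS !factS !natrM.
have nz k : (k`!%:R : R) != 0 by rewrite pnatr_eq0 -lt0n fact_gt0.
have : ((n + m).+1%:R : R) != 0 by rewrite pnatr_eq0.
have -> : ((n - m.+1).+1%:R : R) = n%:R - m%:R by rewrite subnSK // natrB // ltnW.
have := nz (n + m)%N; have := nz (n - m.+1)%N.
move: (_`!%:R) => x; move: (_`!%:R) => z.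
by rewrite -!natr1 natrD => x0 z0 w0; field; exact/andP.
Qed.

Let a n m : R := (n - m)`!%:R / (n + m)`!%:R.

(** The derivative of the left side telescopes through the products [U m], so the left side is
    constant; at x = 1 only P_n(1)^2 = 1 remains. *)
Lemma legendre_addition n :
  (P n) ^+ 2 + 2 * \sum_(m < n) ((n - m.+1)`!%:R / (n + m.+1)`!%:R)%:P
     * (1 - 'X ^+ 2) ^+ m.+1 * ((P n)^`(m.+1)) ^+ 2 = 1.
Proof.
set S := LHS; pose y m := (P n)^`(m).
pose U m := (a n m)%:P * (1 - 'X ^+ 2) ^+ m * y m * y m.+1.
have dS : S^`() = 0.
  rewrite /S derivD deriv_exp derivM raddf_sum /= expr1.
  rewrite (_ : 2^`() = 0) ?mul0r ?add0r; last exact: deriv_natr.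
  transitivity (2 * (U 0%N) + 2 * \sum_(m < n) (U m.+1 - U m)).
    congr (_ + _ * _).
      rewrite /U /a subn0 addn0 divff ?pnatr_eq0 -?lt0n ?fact_gt0 // expr0 polyC1 /y
        derivn0 derivSn derivn0.
      by rewrite -mulr_natl; ring.
    apply: eq_bigr => m _; rewrite /U -/(a n m.+1) -derivnS -/(y m.+1).
    have am := natr_fact_ratio _ _ (ltn_ord m); rewrite -/(a n m) -/(a n m.+1) in am.
    have := legendre_ode n m; rewrite -/(y m) -/(y m.+1) -/(y m.+2).
    have dy : (y m.+1)^`() = y m.+2 by rewrite /y -derivnS.
    have : (1 - 'X ^+ 2 : {poly R})^`() = - (2 * 'X).
      by rewrite derivB derivXn -polyC1 derivC sub0r -mulr_natl.
    rewrite am; move: (a n m.+1) => b; rewrite polyCM polyCB !polyCM !polyC_natr.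
    move: (1 - 'X ^+ 2) (y m.+1) (y m.+2) (y m) dy => W y1 y2 y0 dy dW ode.
    rewrite expr2 !derivM derivC deriv_exp dW dy -mulr_natl /= exprS.
    transitivity (b%:P * W ^+ m * y1 * (2 * (W * y2) - 2 * m.+1%:R * 'X * y1)); first by ring.
    transitivity (b%:P * W ^+ m * y1 * (W * y2
      - (n%:R * n.+1%:R - m%:R * m.+1%:R) * y0)); last by ring.
    by rewrite ode; ring.
  (* The sum collapses to [U n], which contains the vanishing derivative of order n+1 of P_n. *)
  rewrite -mulrDr (_ : U 0%N + _ = 0) ?mulr0 //.
  rewrite -(big_mkord xpredT (fun m => U m.+1 - U m)) telescope_sumr //.
  by rewrite {2}/U /y derivn_legendre_eq0 !mulr0; ring.
have S1 : S.[1] = 1.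
  rewrite /S hornerD horner_exp legendre1 expr1n hornerM horner_sum big1 ?mulr0 ?addr0 //.
  by move=> m _; rewrite 2!hornerM horner_exp !hornerE expr1n subrr expr0n /= mulr0 !mul0r.
by rewrite -polyC1 -S1 [in RHS](deriv_eq0P _ _ dS) hornerC -deriv_eq0P.
Qed.

(* [lint p] below is the integral of p over [-1, 1]. *)
Definition primitive (p : {poly R}) : {poly R} :=
  \poly_(i < (size p).+1) (p`_i.-1 / i%:R).

Lemma deriv_primitive p : (primitive p)^`() = p.
Proof.
apply/polyP => i; rewrite coef_deriv coef_poly ltnS /=.
case: ltnP => [_|/leq_sizeP/(_ i (leqnn _)) ->]; last by rewrite mul0rn.
by rewrite -[LHS]mulr_natr divfK // pnatr_eq0.
Qed.

Definition lint p := (primitive p).[1] - (primitive p).[-1].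

(** The primitive of the derivative differs from p by a constant, so any antiderivative computes
    [lint]; linearity follows from this. *)
Lemma lint_deriv p : lint p^`() = p.[1] - p.[-1].
Proof.
rewrite /lint; set q := primitive _.
have /deriv_eq0P H : (q - p)^`() = 0 by rewrite derivB deriv_primitive subrr.
have -> : q = p + (q - p)  by ring.
by rewrite H !hornerE /=; ring.
Qed.

Lemma lintD p1 p2 : lint (p1 + p2) = lint p1 + lint p2.
Proof.
rewrite -{1}(deriv_primitive p1) -{1}(deriv_primitive p2) -derivD lint_deriv !hornerE /lint /=.
by ring.
Qed.

Lemma lintZ c p : lint (c *: p) = c * lint p.
Proof. by rewrite -{1}(deriv_primitive p) -derivZ lint_deriv !hornerE /lint /=; ring. Qed.

Lemma lint_sum n (F : 'I_n -> {poly R}) : lint (\sum_(i < n) F i) = \sum_(i < n) lint (F i).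
Proof.
apply: (big_morph lint lintD); by rewrite -(scale0r 0) lintZ mul0r.
Qed.

(** Inner product of the associated Legendre functions of order m: the signs cancel and the two
    roots combine into (1-x^2)^m. *)
Definition Lprod m n l := lint ((1 - 'X ^+ 2) ^+ m * (P n)^`(m) * (P l)^`(m)).

Lemma LprodC m n l : Lprod m n l = Lprod m l n.
Proof. by rewrite /Lprod mulrAC. Qed.

(** Integration by parts: (1-x^2)^(m+1) P_n^(m+1) P_l^(m) vanishes at -1 and 1, and the Legendre
    equation rewrites its derivative. *)
Lemma LprodS m n l : Lprod m.+1 n l = (n%:R * n.+1%:R - m%:R * m.+1%:R) * Lprod m n l.
Proof.
rewrite /Lprod.
set c : R := _ - _.
set y0 := (P n)^`(m); set y1 := (P n)^`(m.+1); set z0 := (P l)^`(m); set z1 := (P l)^`(m.+1).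
pose W : {poly R} := 1 - 'X ^+ 2; rewrite -/W.
have dW : W^`() = - (2 * 'X).
  by rewrite derivB derivXn -polyC1 derivC sub0r -mulr_natl.
have E : (W ^+ m.+1 * y1 * z0)^`() = W ^+ m.+1 * y1 * z1 + (- c) *: (W ^+ m * y0 * z0).
  have := legendre_ode n m; rewrite -/W -/y0 -/y1 => ode.
  rewrite !derivM deriv_exp dW -!derivnS -/z1 -mulr_natl -mul_polyC /= exprS.
  transitivity (W ^+ m * z0 * (W * (P n)^`(m.+2) - 2 * m.+1%:R * 'X * y1)
    + W * W ^+ m * y1 * z1); first by ring.
  by rewrite ode /c polyCN polyCB !polyCM !polyC_natr; ring.
have := lint_deriv (W ^+ m.+1 * y1 * z0).
rewrite E lintD lintZ !hornerM !horner_exp /W !hornerE sqrrN expr1n subrr !expr0n /= !mul0r subrr.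
by move/eqP; rewrite mulNr subr_eq0 => /eqP.
Qed.

Lemma Lprod_neq m n l : n != l -> Lprod m n l = 0.
Proof.
move=> nl; elim: m => [|m IH]; last by rewrite LprodS IH mulr0.
(* Applying the equation to either factor multiplies the same integral by n(n+1) and by l(l+1),
   which differ. *)
have := LprodS 0 n l; rewrite LprodC LprodS LprodC => /eqP.
rewrite -subr_eq0 -mulrBl mulf_eq0 => /orP[|/eqP //].
rewrite !mul0r !subr0 -!natrM -[_ == _]/(_ == _) subr_eq0 eqr_nat => /eqP H.
move: nl; case: (ltngtP n l) => // ln _.
  by have := ltn_mul ln (ln : (n.+1 < l.+1)%N); rewrite H ltnn.
by have := ltn_mul ln (ln : (l.+1 < n.+1)%N); rewrite H ltnn.
Qed.

(** The factor gained by [LprodS] is the one lost by the factorial ratio, so the normalised norm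
    does not depend on the order. *)
Lemma Lprod_fact m n : (m <= n)%N -> (n - m)`!%:R / (n + m)`!%:R * Lprod m n n = Lprod 0 n n.
Proof.
elim: m => [|m IH] mn; first by rewrite subn0 addn0 divff ?mul1r // pnatr_eq0 -lt0n fact_gt0.
rewrite -IH ?(ltnW mn) // LprodS mulrA; congr (_ * _).
by apply/esym/natr_fact_ratio.
Qed.

Lemma Lprod0 n : (2 * n + 1)%:R * Lprod 0 n n = 2.
Proof.
have := congr1 lint (legendre_addition n).
have -> : lint 1 = 2.
  by rewrite -(derivX R) lint_deriv !hornerE /=; ring.
rewrite lintD -(polyC_natr _ 2) mul_polyC lintZ lint_sum.
(* Each of the n summands normalises to the integral of order 0, which is thus counted 1 + 2n
   times. *)
under eq_bigr => i _ do
  rewrite -!mulrA mul_polyC lintZ expr2 !mulrA -/(Lprod i.+1 n n) Lprod_fact //.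
rewrite sumr_const card_ord => <-.
rewrite /Lprod expr0 mul1r derivn0 -expr2 -mulr_natl natrD natrM; ring.
Qed.

Lemma Lprod_diag m n : (m <= n)%N ->
  (2 * n + 1)%:R * ((n - m)`!%:R / (n + m)`!%:R) * Lprod m n n = 2.
Proof. by move=> mn; rewrite -mulrA Lprod_fact // Lprod0. Qed.

End Legendre.

(** * Positive definite matrices and the criteria *)

Section Definite.
Variable F : realFieldType.

Definition quad {n} (M : 'M[F]_n) (v : 'rV[F]_n) : F := (v *m M *m v^T) 0 0.

Definition possemidef {n} (M : 'M[F]_n) : Prop :=
  M^T = M /\ forall v, 0 <= quad M v.

Definition posdef {n} (M : 'M[F]_n) : Prop :=
  M^T = M /\ forall v, v != 0 -> 0 < quad M v.

Lemma quad1_ge0 n (v : 'rV[F]_n) : 0 <= quad 1%:M v.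
Proof.
rewrite /quad mulmx1 mxE; apply: sumr_ge0 => i _.
by rewrite mxE -expr2 sqr_ge0.
Qed.

Lemma quad1_eq0 n (v : 'rV[F]_n) : (quad 1%:M v == 0) = (v == 0).
Proof.
apply/eqP/eqP => [|->]; last by rewrite /quad !mul0mx mxE.
rewrite /quad mulmx1 mxE => /eqP; rewrite psumr_eq0 => [/allP v0|i _]; last first.
  by rewrite mxE -expr2 sqr_ge0.
apply/rowP => i; rewrite mxE; have := v0 i (mem_index_enum i).
by rewrite mxE -expr2 sqrf_eq0 => /eqP.
Qed.

Lemma quad_congr n m (M : 'M[F]_n) (Q : 'M[F]_(m, n)) v :
  quad (Q *m M *m Q^T) v = quad M (v *m Q).
Proof. by rewrite /quad trmx_mul !mulmxA. Qed.

(** With w = v M, the form at v + t w equals 2 t |w|^2 + t^2 q(w), which a suitable negative t makes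
    negative unless w = 0. *)
Lemma possemidef_ker n (M : 'M[F]_n) v : possemidef M -> quad M v = 0 -> v *m M = 0.
Proof.
move=> [Ms Mp] v0; set w := v *m M.
have E t : quad M (v + t *: w) = 2 * t * quad 1%:M w + t ^+ 2 * quad M w.
  have wv : (w *m M *m v^T) 0 0 = quad 1%:M w.
    by rewrite /quad mulmx1 [in w^T]/w trmx_mul Ms mulmxA.
  have vw : (v *m M *m w^T) 0 0 = quad 1%:M w by rewrite -/w /quad mulmx1.
  rewrite [LHS]/quad raddfD /= [(t *: w)^T]linearZ /= !(mulmxDl, mulmxDr) -!scalemxAl -!scalemxAr.
  rewrite ![fun_of_matrix (_ + _) _ _]mxE ![fun_of_matrix (_ *: _) _ _]mxE
    wv vw -/(quad M v) v0 -/(quad M w).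
  by ring.
apply/eqP; rewrite -quad1_eq0; set b := quad 1%:M w.
have b0 : 0 <= b := quad1_ge0 _ w.
have c0 := Mp w; set c := quad M w in c0.
(* The 1 in the denominator keeps it positive even when c = 0. *)
have := Mp (v + (- b / (c + 1)) *: w); rewrite E -/b -/c.
have c1 : 0 < c + 1 by rewrite ltr_wpDl.
have -> : 2 * (- b / (c + 1)) * b + (- b / (c + 1)) ^+ 2 * c = - (b ^+ 2 * (c + 2) / (c + 1) ^+ 2).
  by field; rewrite gt_eqF.
rewrite oppr_ge0 pmulr_lle0 ?invr_gt0 ?exprn_gt0 // pmulr_lle0 ?ltr_wpDl // => b2.
by rewrite -sqrf_eq0 eq_le b2 sqr_ge0.
Qed.

Lemma posdef_unit n (M : 'M[F]_n) : posdef M -> M \in unitmx.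
Proof.
move=> [_ Mp]; rewrite unitmxE unitfE; apply/negP => /det0P [v v0 vM].
by have := Mp v v0; rewrite /quad vM mul0mx mxE ltxx.
Qed.

Lemma posdef_inv n (M : 'M[F]_n) : posdef M -> posdef (invmx M).
Proof.
move=> Mp; have uM := posdef_unit _ _ Mp; case: Mp => Ms Mp.
have sV : (invmx M)^T = invmx M by rewrite trmx_inv Ms.
split=> // v v0.
have -> : invmx M = invmx M *m M *m (invmx M)^T by rewrite mulVmx // mul1mx sV.
rewrite quad_congr Mp //; apply: contraNneq v0 => /(congr1 (mulmx^~ M)).
by rewrite mulmxKV // mul0mx => ->.
Qed.

Lemma posdef_eigenvalue_gt0 n (M : 'M[F]_n) x : posdef M -> root (char_poly M) x -> 0 < x.
Proof.
move=> [_ Mp]; rewrite -eigenvalue_root_char => /eigenvalueP [v vM v0].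
have := Mp v v0; rewrite /quad vM -scalemxAl mxE => h.
have := quad1_ge0 _ v; rewrite /quad mulmx1 => h1.
rewrite ltNge; apply/negP => x0; move: h.
by rewrite ltNge mulr_le0_ge0.
Qed.

Lemma tr_possemidef_congr n m (M : 'M[F]_n) (Q : 'M[F]_(m, n)) :
  possemidef M -> 0 <= \tr (Q *m M *m Q^T).
Proof.
move=> [_ Mp]; apply: sumr_ge0 => i _.
suff -> : (Q *m M *m Q^T) i i = quad M (row i Q) by apply: Mp.
by rewrite /quad -row_mul tr_row [in LHS]mxE [in RHS]mxE; apply: eq_bigr => j _; rewrite !mxE.
Qed.

(** * Schur complement of a scalar block *)

Section Schur.
Variables (n : nat) (a : F) (b : 'rV[F]_n) (D : 'M[F]_n).
Let C : 'M[F]_(1 + n) := block_mx a%:M b b^T D.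
Let S := D - a^-1 *: (b^T *m b).

Lemma det_schur : a != 0 -> \det C = a * \det S.
Proof.
move=> a0.
have -> : C = block_mx 1%:M 0 (a^-1 *: b^T) 1%:M *m block_mx a%:M b 0 S.
  rewrite mulmx_block !mul1mx !mul0mx !addr0 mul_mx_scalar scalerA mulfV // scale1r.
  by rewrite /S -scalemxAl addrC subrK.
by rewrite det_mulmx det_lblock det_ublock !det1 !mul1r det_scalar1.
Qed.

Lemma posdef_schur : posdef C -> 0 < a /\ posdef S.
Proof.
move=> [Cs Cp].
have a0 : 0 < a.
  have := Cp (row_mx 1%:M 0); rewrite /quad tr_row_mx mul_row_block !mul0mx !mul1mx !addr0.
  rewrite mul_row_col trmx0 mulmx0 addr0 trmx1 mulmx1 mxE eqxx mulr1n; apply.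
  apply/eqP => /(congr1 lsubmx); rewrite row_mxKl linear0 => /matrixP/(_ 0 0).
  by rewrite !mxE => /eqP; rewrite oner_eq0.
split=> //; split.
  move: Cs; rewrite /C tr_block_mx => /eq_block_mx [_ _ _ Ds].
  by rewrite /S linearB linearZ /= trmx_mul trmxK Ds.
(* For given v this first coordinate minimises the form of [C], and the minimum is the form of [S]
   at v. *)
move=> v v0; have := Cp (row_mx (- a^-1 *: (v *m b^T)) v).
have -> : quad C (row_mx (- a^-1 *: (v *m b^T)) v) = quad S v.
  rewrite /quad tr_row_mx mul_row_block mul_row_col; congr (fun_of_matrix _ 0 0).
  rewrite mul_mx_scalar scalerA mulrN mulfV ?gt_eqF // scaleN1r addNr mul0mx add0r.
  congr (_ *m _); rewrite /S mulmxBr addrC -scalemxAl -scalemxAr mulmxA.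
  by rewrite scaleNr.
apply; apply: contraNneq v0 => /(congr1 rsubmx).
by rewrite row_mxKr linear0 => ->.
Qed.

Lemma trace_schur : 0 < a -> \tr S <= \tr D.
Proof.
move=> a0; rewrite /S linearB linearZ /= gerBl mulr_ge0 ?invr_ge0 ?(ltW a0) //.
rewrite mxtrace_mulC trace_mx11.
by have := quad1_ge0 _ b; rewrite /quad mulmx1.
Qed.

End Schur.

Lemma CK_posdef_trace n s (K : 'M[F]_(n, s)) (M : 'M[F]_n) :
  possemidef M -> (K^T <= M^T)%MS -> K^T *m K = 1%:M ->
  let C := invmx (K^T *m pinvmx M *m K) in
  posdef C /\ \tr C <= \tr (K^T *m M *m K).
Proof.
move=> Mp; have Ms := Mp.1; rewrite Ms => /submxP [D KD] KK.
have KD' : K = M *m D^T by rewrite -(trmxK K) KD trmx_mul Ms.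
(* K factors through M on both sides, so M M^- M = M eliminates the generalized inverse. *)
have -> : K^T *m pinvmx M *m K = D *m M *m D^T.
  by rewrite KD KD' mulmxA mulmxKpV // submxMl.
set A := D *m M *m D^T => C.
have Ap : posdef A.
  split=> [|v v0]; first by rewrite /A !trmx_mul trmxK Ms mulmxA.
  (* A zero of the form gives v D M = v K^T = 0, and multiplying by K returns v = 0. *)
  rewrite /A quad_congr lt_def Mp.2 andbT; apply: contraNneq v0 => /(possemidef_ker _ _ _ Mp).
  by rewrite -mulmxA -KD => /(congr1 (mulmx^~ K)); rewrite -mulmxA KK mulmx1 mul0mx => ->.
have Cp : posdef C := posdef_inv _ _ Ap.
split=> //.
(* With this factor both cross terms and the leading square equal [C], which leaves K^T M K - C. *)
have := tr_possemidef_congr _ _ _ (C *m D - K^T) Mp.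
suff -> : (C *m D - K^T) *m M *m (C *m D - K^T)^T = K^T *m M *m K - C.
  by rewrite linearB subr_ge0.
rewrite [(_ - _)^T]linearB /= trmx_mul trmxK Cp.1 !(mulmxBl, mulmxBr).
have e1 : C *m D *m M *m (D^T *m C) = C.
  by rewrite !mulmxA -!(mulmxA C) mulmxA -/A mulVmx ?mul1mx // posdef_unit.
have e2 : C *m D *m M *m K = C by rewrite -(mulmxA C) -KD -mulmxA KK mulmx1.
have e3 : K^T *m M *m (D^T *m C) = C by rewrite mulmxA -(mulmxA _ M) -KD' KK mul1mx.
by rewrite e1 e2 e3 subrr sub0r opprB.
Qed.

End Definite.

(** * Trace bounds for the optimality criteria *)

Section Criteria.
Variable R : realType.

(** Determinant form of ln x <= x - 1. Induction on the size through the Schur complement avoids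
    eigenvalues: the pivot satisfies a <= exp(a - 1), and the complement has trace at most that of
    [D]. *)
Lemma posdef_det n (C : 'M[R]_n) : posdef _ C -> 0 < \det C <= expR (\tr C - n%:R).
Proof.
elim: n C => [|n IH] C Cp.
  by rewrite det_mx00 /mxtrace big_ord0 subr0 expR0 ltr01 lexx.
have [a [b [D CE]]] : exists (a : R) (b : 'rV[R]_n) (D : 'M[R]_n),
    C = block_mx a%:M b b^T D :> 'M[R]_(1 + n).
  exists (C 0 0), (@ursubmx _ 1 n 1 n C), (@drsubmx _ 1 n 1 n C).
  rewrite -[LHS](@submxK _ 1 n 1 n) [in RHS]trmx_ursub Cp.1; congr block_mx.
  by rewrite [LHS]mx11_scalar !mxE; congr (C _ _)%:M; apply/val_inj.
move: C CE Cp; rewrite -[n.+1]/(1 + n)%N => _ -> Cp.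
have [a0 Sp] := posdef_schur _ _ _ _ _ Cp.
have /andP[d0 d1] := IH _ Sp.
rewrite det_schur ?gt_eqF // mulr_gt0 //= mxtrace_block trace_mx11 mxE eqxx mulr1n.
have -> : a + \tr D - (1 + n)%:R = (a - 1) + (\tr D - n%:R) by rewrite natrD; ring.
rewrite expRD ler_pM ?(ltW a0) ?(ltW d0) //.
  by have := expR_ge1Dx (a - 1); rewrite addrC subrK.
by apply: le_trans d1 _; rewrite ler_expR lerD2r; exact: trace_schur.
Qed.

(** [xget] returns the default [[::]] if no splitting exists. Treating this outcome separately
    replaces a spectral theorem in what follows. *)
Lemma eigs_or_nil n (C : 'M[R]_n) :
  eigs C = [::] \/ char_poly C = \prod_(x <- eigs C) ('X - x%:P).
Proof.
rewrite /eigs; case: xgetP => [l _ /= H|_]; by [right | left].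
Qed.

Lemma mem_eigs_gt0 n (C : 'M[R]_n) x : posdef _ C -> x \in eigs C -> 0 < x.
Proof.
move=> Cp xC; apply: posdef_eigenvalue_gt0 (Cp) _.
case: (eigs_or_nil _ C) => [E|->]; first by rewrite E in xC.
by rewrite root_prod_XsubC.
Qed.

(** The degree and the subleading coefficient of the characteristic polynomial give the two
    values. *)
Lemma size_sum_eigs n (C : 'M[R]_n) : eigs C != [::] ->
  size (eigs C) = n /\ \sum_(x <- eigs C) x = \tr C.
Proof.
case: (eigs_or_nil _ C) => [->//|E] n0.
have sz : size (eigs C) = n.
  by have := size_char_poly C; rewrite E size_prod_XsubC => -[].
split=> //; apply: oppr_inj.
have n1 : (0 < n)%N by rewrite -sz lt0n size_eq0.
rewrite -(char_poly_trace _ n1) E.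
by have := @coefPn_prod_XsubC _ (eigs C); rewrite sz -lt0n => /(_ n1) ->.
Qed.

(** The chosen list is a priori unknown, but two factorisations into linear factors are permutations
    of each other, and a constant list has only itself as permutation. *)
Lemma eigs1 n : eigs (1%:M : 'M[R]_n) = nseq n 1.
Proof.
have cp : char_poly (1%:M : 'M[R]_n) = \prod_(x <- nseq n 1) ('X - x%:P).
  rewrite char_poly_trig ?scalar_mx_is_trig // big_nseq.
  rewrite (eq_bigr (fun=> 'X - 1%:P)) => [|i _]; last by rewrite mxE eqxx.
  by rewrite big_const_ord.
rewrite /eigs; case: xgetP => [l _ /= H|/(_ (nseq n 1)) /= //].
rewrite cp in H.
have pl := prod_XsubC_eq H.
rewrite -[n in RHS](size_nseq n (1 : R)) (perm_size pl).
apply/all_pred1P; rewrite -(perm_all _ pl).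
by apply/all_pred1P; rewrite size_nseq.
Qed.

Lemma powR_le_tangent (r x : R) : 0 < r -> r < 1 -> 0 < x -> x `^ r <= 1 + r * (x - 1).
Proof.
move=> r0 r1 x0; rewrite /powR gt_eqF //; set t := ln x.
have -> : x = expR t by rewrite lnK // posrE.
set e := expR (r * t); have e0 : 0 < e := expR_gt0 _.
have h1 : e * (1 + (1 - r) * t) <= expR t.
  have -> : t = r * t + (1 - r) * t by ring.
  rewrite expRD -/e ler_pM2l // {1}(_ : r * t + _ = t); last by ring.
  exact: expR_ge1Dx.
have h2 : e * (1 - r * t) <= 1.
  by rewrite -ler_pdivlMl // mulr1 -expRN; exact: expR_ge1Dx.
(* The convex combination with weights r and 1 - r cancels the terms in t and leaves e = x^r on the
   left. *)
have : r * (e * (1 + (1 - r) * t)) + (1 - r) * (e * (1 - r * t))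
   <= r * expR t + (1 - r) * 1 by rewrite lerD // ler_pM2l // subr_gt0.
by congr (_ <= _); ring.
Qed.

(** Two tangent bounds: exp(r ln x) >= 1 + r ln x, and ln x <= x - 1 is reversed by the negative
    r. *)
Lemma powR_ge_tangent (r x : R) : r < 0 -> 0 < x -> 1 + r * (x - 1) <= x `^ r.
Proof.
move=> r0 x0; rewrite /powR gt_eqF //.
apply: le_trans (expR_ge1Dx _); rewrite lerD2l ler_nM2l //.
have := ln_sublinear; have := expR_ge1Dx (ln x); rewrite lnK ?posrE //.
lra.
Qed.

Lemma Phi_mx_le1 (p : \bar R) n (C : 'M[R]_n) : (0 < n)%N -> (p < 1%:E)%E ->
  posdef _ C -> \tr C <= n%:R -> Phi_mx p C <= Phi_mx p (1%:M : 'M[R]_n).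
Proof.
move=> n0 p1 Cp tC; case: p p1 => [r|//|_] /=; last first.
  rewrite eigs1; have -> : \big[Num.min/head 0 (nseq n 1)]_(x <- nseq n 1) x = 1 :> R.
    case: n n0 {C Cp tC} => // n _; rewrite /= big_cons.
    by elim: n => [|n IH] /=; rewrite ?big_nil ?minxx // big_cons IH minxx.
  (* For an empty list the minimum is its default value 0. *)
  case E : (eigs C) => [|y l]; first by rewrite big_nil.
  have [|sz sm] := size_sum_eigs _ C; first by rewrite E.
  (* A minimum above 1 would push the sum of the n eigenvalues, the trace, above n. *)
  rewrite leNgt; apply/negP => lt1.
  have all1 x : x \in eigs C -> 1 < x.
    rewrite E => xl; apply: lt_le_trans lt1 _.
    exact: (@ge_bigmin_seq _ _ _ _ _ x xpredT id xl).
  suff : n%:R < \tr C by rewrite ltNge tC.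
  have nE : n%:R = \sum_(x <- eigs C) 1 :> R
    by rewrite big_const_seq iter_addr addr0 count_predT sz.
  rewrite -sm nE !big_seq; apply: ltr_sum => //.
  by apply/hasP; exists y; rewrite E mem_head.
rewrite lte_fin => r1; case: eqP => [_|/eqP r0].
  rewrite det1; apply: le_trans (andP (posdef_det _ _ Cp)).2 _.
  by rewrite -[X in _ <= X]expR0 ler_expR subr_le0.
rewrite eigs1; have -> : \sum_(x <- nseq n 1) x `^ r = n%:R.
  by rewrite big_nseq powR1 iter_addr addr0.
(* For an empty list the criterion is 0 to the power 1/r, which is 0. *)
have [E|nE] := eqVneq (eigs C) [::].
  by rewrite E big_nil powR0 ?invr_eq0 // powR_ge0.
have [sz sm] := size_sum_eigs _ C nE.
have tg : \sum_(x <- eigs C) (1 + r * (x - 1)) = n%:R + r * (\tr C - n%:R).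
  have nE1 : n%:R = \sum_(x <- eigs C) 1 :> R
    by rewrite big_const_seq iter_addr addr0 count_predT sz.
  by rewrite nE1 -sm big_split /= -mulr_sumr sumrB.
(* For r < 0 the tangent bound on the power sum is from below, but the outer exponent 1/r is
   decreasing, so both signs give the same final inequality. *)
have [rn|rp] := ltP r 0.
  have h : n%:R <= \sum_(x <- eigs C) x `^ r.
    apply: le_trans (_ : \sum_(x <- eigs C) (1 + r * (x - 1)) <= _).
      by rewrite tg lerDl nmulr_rge0 // subr_le0.
    rewrite !big_seq; apply: ler_sum => x xC; apply: powR_ge_tangent => //.
    exact: mem_eigs_gt0 xC.
  rewrite -[r^-1]opprK !(powRN _ (- r^-1)) lef_pV2 ?posrE ?powR_gt0 ?ltr0n //.
    apply: ge0_ler_powR => //; rewrite ?nnegrE ?ler0n //.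
    + by rewrite oppr_ge0 invr_le0 ltW.
    + exact: le_trans h.
  by apply: lt_le_trans h; rewrite ltr0n.
have {}r0 : 0 < r by rewrite lt_def r0.
apply: ge0_ler_powR; rewrite ?nnegrE ?ler0n ?invr_ge0 //.
  by apply: sumr_ge0 => x _; exact: powR_ge0.
apply: le_trans (_ : \sum_(x <- eigs C) (1 + r * (x - 1)) <= _).
  rewrite !big_seq; apply: ler_sum => x xC; apply: powR_le_tangent => //.
  exact: mem_eigs_gt0 xC.
by rewrite tg gerDl pmulr_rle0 // subr_le0.
Qed.

End Criteria.

(** * Integration on the sphere *)

Section Density.
Context d (T : measurableType d) (R : realType).
Variables (nu : {finite_measure set T -> \bar R})
          (mu : {sigma_finite_measure set T -> \bar R}).
Local Open Scope ereal_scope.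

(** [g] agrees almost everywhere with the Radon-Nikodym derivative, since both integrate to [nu]
    over every measurable set. *)
Lemma integral_density (g f : T -> \bar R) D : measurable D ->
  mu.-integrable setT g -> (forall A, measurable A -> nu A = \int[mu]_(x in A) g x) ->
  nu.-integrable D f ->
  \int[nu]_(x in D) f x = \int[mu]_(x in D) (f x * g x).
Proof.
move=> mD ig nuE intf.
have mg (A : set T) : measurable_fun A g by apply: measurable_funTS; exact: measurable_int ig.
have dom : nu `<< mu.
  by apply/null_content_dominatesP => A mA A0; rewrite nuE // null_set_integral.
rewrite -(Radon_Nikodym_change_of_variables dom mD intf).
apply: ae_eq_integral => //.
- apply: emeasurable_funM; first exact: measurable_int intf.
  by apply: measurable_funTS.
- by apply: emeasurable_funM; first exact: measurable_int intf.
- apply: ae_eqe_mul2l.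
  apply: integral_ae_eq => //.
  + apply: (integrableS measurableT) => //; exact: Radon_Nikodym_integrable.
  + by move=> A AD mA; rewrite -nuE // -Radon_Nikodym_integral.
Qed.

Lemma integrable_bounded (B : R) (m : {measure set T -> \bar R}) (f : T -> R) D :
  measurable D -> m D < +oo -> measurable_fun setT f -> (forall t, `|f t| <= B)%R ->
  m.-integrable D (EFin \o f).
Proof.
move=> mD fD mf bf; apply: measurable_bounded_integrable => //; first exact: measurable_funTS.
by exists B; split; rewrite ?num_real // => y By t _; exact: le_trans (bf t) (ltW By).
Qed.
End Density.

(** * The uniform density and Fubini *)

Section Sphere.
Context (R : realType).
Local Notation L := (measurableTypeR R * measurableTypeR R)%type.
Local Open Scope ereal_scope.

(* A new name for the product measure: on [\x] itself the sigma-finite structure is not inferred,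
   because the instance for products of probabilities takes precedence. *)
Definition leb2 : set L -> \bar R := @lebesgue_measure R \x @lebesgue_measure R.

HB.instance Definition _ := Measure.on leb2.

Lemma sigma_finite_leb2 : sigma_finite setT leb2.
Proof.
have [F TF Ffin] := sigma_finiteT (@lebesgue_measure R).
(* Enumerates the products of two covering sets; a code of no pair gives the empty set. *)
pose G (n : nat) : set L :=
  if @unpickle (nat * nat)%type n is Some ij then F ij.1 `*` F ij.2 else set0.
exists G.
  apply/esym; rewrite -subTset => -[x y] _.
  have [i _ Fx] : (\bigcup_i F i) x by rewrite -TF.
  have [j _ Fy] : (\bigcup_i F i) y by rewrite -TF.
  by exists (pickle (i, j)) => //; rewrite /G pickleK.
move=> n; rewrite /G; case: unpickle => [[i j]|]; last by rewrite measure0.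
have [mi fi] := Ffin i; have [mj fj] := Ffin j.
split; first exact: measurableX.
by rewrite /leb2 product_measure1E // lte_mul_pinfty // ge0_fin_numE.
Qed.

HB.instance Definition _ := Measure_isSigmaFinite.Build _ _ _ leb2 sigma_finite_leb2.

(* [R] and [measurableTypeR R] have the same measurable sets but distinct (opaque) displays, so
   measures are transported along this identity before being compared. *)
Definition to_leb : (R * R)%type -> L := id.

Lemma measurable_to_leb (D : set (R * R)%type) : measurable_fun D to_leb.
Proof. by move=> mD Y mY; apply: measurableI. Qed.

HB.instance Definition _ := isMeasurableFun.Build _ _ _ _ to_leb (measurable_to_leb setT).

Lemma measurable_dspace : measurable (@dspace R : set L).
Proof. by apply: measurableX; exact: measurable_itv. Qed.

(** Extended by 0 outside the domain, to be integrable over the whole plane. *)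
Definition sphere_density (t : L) : R := \1_(@dspace R) t * (sin t.1 / (4 * pi)).

Lemma leb2_dspace : leb2 (@dspace R) < +oo.
Proof.
rewrite /leb2 product_measure1E //.
by rewrite /= !lebesgue_measure_itv /=; do 2 case: ifP => _; rewrite -?EFinB -?EFinM ?mule0 ?mul0e ltry.
Qed.

Lemma measurable_fst_leb (g : R -> R) : measurable_fun setT g ->
  measurable_fun setT (fun t : L => g t.1).
Proof. by move=> mg; apply: (measurableT_comp mg); exact: measurable_fst. Qed.

Lemma measurable_snd_leb (g : R -> R) : measurable_fun setT g ->
  measurable_fun setT (fun t : L => g t.2).
Proof. by move=> mg; apply: (measurableT_comp mg); exact: measurable_snd. Qed.

Lemma measurable_sin_fst : measurable_fun setT (fun t : L => sin t.1 / (4 * pi) : R)%R.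
Proof.
apply: measurable_funM => //; apply: measurable_fst_leb.
by apply: continuous_measurable_fun; exact: continuous_sin.
Qed.

Lemma integrable_sphere_density : leb2.-integrable setT (EFin \o sphere_density).
Proof.
have -> : EFin \o sphere_density = (EFin \o (fun t : L => sin t.1 / (4 * pi))%R) \_ (@dspace R).
  apply/funext => t; rewrite /= /sphere_density patchE indicE.
  by case: ifP => _; rewrite ?mul1r ?mul0r.
apply/integrable_restrict => //; first exact: measurable_dspace.
rewrite setTI; apply: (integrable_bounded _ _ _ (4 * pi)^-1 _ _ _ measurable_dspace leb2_dspace).
- exact: measurable_sin_fst.
- move=> t; rewrite normrM [X in (_ * X)%R]ger0_norm ?invr_ge0 ?mulr_ge0 ?pi_ge0 //.
  rewrite ler_piMl ?invr_ge0 ?mulr_ge0 ?pi_ge0 //.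
  by rewrite ler_norml sin_geN1 sin_le1.
Qed.

Lemma integral_uniform_sphere (xi : probability (R * R)%type R) (f : (R * R)%type -> R) :
  is_uniform_sphere xi -> measurable_fun setT f -> (exists B, forall t, `|f t| <= B)%R ->
  (\int[xi]_(t in @dspace R) (f t)%:E = 
   \int[leb2]_(t in @dspace R) (f t * (sin t.1 / (4 * pi)))%:E)%E.
Proof.
move=> xiU mf [B bf].
have mdL := measurable_dspace.
have intf (D : set (R * R)%type) : measurable D -> xi.-integrable D (EFin \o f).
  move=> mD; apply: (integrable_bounded _ _ _ B) => //.
  by rewrite (le_lt_trans (probability_le1 _ _)) // ltry.
(* The image of [xi] under the identity lives on the same measurable space as [leb2], so the density
   lemma applies to it. *)
pose nu := distribution xi (to_leb : {mfun _ >-> _}).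
have nuE (A : set L) : measurable A -> nu A = \int[leb2]_(x in A) (EFin \o sphere_density) x.
  move=> mA; rewrite /nu /distribution /pushforward preimage_id xiU // integral_mkcondr.
  apply: eq_integral => t _; rewrite /= /sphere_density patchE indicE.
  by case: ifP => _; rewrite ?mul1r ?mul0r.
have := @integral_density _ L R nu leb2 (EFin \o sphere_density) (EFin \o f) (@dspace R) mdL
   integrable_sphere_density nuE.
have mfL : measurable_fun [set: L] (EFin \o f).
  by apply/measurable_EFinP.
rewrite (integral_pushforward (measurable_to_leb setT) mfL (intf _ mdL) mdL) => ->.
  apply: eq_integral => t tD.
  by rewrite /= /sphere_density indicE tD mul1r.
exact: (integrable_pushforward (measurable_to_leb setT) mfL (intf _ mdL) mdL).
Qed.

Local Notation lam := (@lebesgue_measure R).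

Lemma integral_leb2_prod (g h : R -> R) (B C : R) :
  measurable_fun setT g -> measurable_fun setT h ->
  (forall x, `|g x| <= B)%R -> (forall x, `|h x| <= C)%R ->
  \int[leb2]_(t in @dspace R) (g t.1 * h t.2)%:E =
  (\int[lam]_(x in `[0%R, pi]) (g x)%:E) * (\int[lam]_(y in `](- pi)%R, pi]) (h y)%:E).
Proof.
move=> mg mh bg bh.
have lamfin (i : interval R) : i = `[0%R, pi] \/ i = `](- pi)%R, pi] -> lam [set` i] < +oo.
  by move=> [] ->; rewrite lebesgue_measure_itv /=; case: ifP => _; rewrite -?EFinB ltry.
have ig : lam.-integrable `[0%R, pi] (EFin \o g).
  by apply: (integrable_bounded _ _ _ B) => //; apply: lamfin; left.
have ih : lam.-integrable `](- pi)%R, pi] (EFin \o h).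
  by apply: (integrable_bounded _ _ _ C) => //; apply: lamfin; right.
have ig1 : lam.-integrable setT ((EFin \o g) \_ `[0%R, pi]).
  by apply/integrable_restrict => //; rewrite setTI.
have ih1 : lam.-integrable setT ((EFin \o h) \_ `](- pi)%R, pi]).
  by apply/integrable_restrict => //; rewrite setTI.
have igh : leb2.-integrable setT ((fun t : L => (g t.1 * h t.2)%:E) \_ (@dspace R)).
  apply/integrable_restrict => //; first exact: measurable_dspace.
  rewrite setTI; apply: (integrable_bounded _ _ _ (B * C) _ _ _ measurable_dspace leb2_dspace).
  - apply: measurable_funM; [exact: measurable_fst_leb | exact: measurable_snd_leb].
  - by move=> t; rewrite normrM ler_pM.
rewrite [LHS]integral_mkcond -(integral12_prod_meas1 igh) /fubini_F.
(* Naming the inner integral as a real number allows it to be pulled out as a constant. *)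
have [H HE] : exists H, \int[lam]_(y in `](- pi)%R, pi]) (h y)%:E = H%:E.
  by exists (fine (\int[lam]_(y in `](- pi)%R, pi]) (h y)%:E)); rewrite fineK // integrable_fin_num.
rewrite HE [in RHS]integral_mkcond -integralZr //.
apply: eq_integral => x _; rewrite -HE [in RHS]integral_mkcond.
rewrite !patchE; case: ifP => xD.
  rewrite -integralZl //; apply: eq_integral => y _.
  rewrite !patchE /dspace in_setX /= xD /=; case: ifP => _; rewrite ?mule0 //.
rewrite mul0e integral0_eq // => y _.
by rewrite patchE /dspace in_setX /= xD.
Qed.

End Sphere.

(** * Integrals over each angle *)

Section OneDim.
Context (R : realType).
Local Notation lam := (@lebesgue_measure R).

Lemma integral_FTC (F f : R -> R) (a b : R) : (a < b)%R ->
  continuous f -> (forall x : R, is_derive x 1 F (f x)) ->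
  (\int[lam]_(x in `[a, b]) (f x)%:E = (F b - F a)%:E)%E.
Proof.
move=> ab cf dF.
have cF x : {for x, continuous F}.
  by apply/differentiable_continuous/derivable1_diffP; have [] := dF x.
rewrite (@continuous_FTC2 _ f F) //.
- exact: continuous_subspaceT.
- split; first by move=> x _; have [] := dF x.
  + exact/cvg_at_right_filter/cF.
  + exact/cvg_at_left_filter/cF.
- by move=> x _; rewrite derive1E; have [_ ->] := dF x.
Qed.

(** The substitution x = cos theta, carried out through the explicit antiderivative below; it
    reduces polar integrals to the algebraic [lint]. *)
Lemma integral_horner_cos (p : {poly R}) :
  (\int[lam]_(x in `[0%R, pi]) (p.[cos x] * sin x)%:E = (lint _ p)%:E)%E.
Proof.
pose F : R -> R := - (horner (primitive _ p) \o @cos R).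
have dF (x : R) : is_derive x 1 F (p.[cos x] * sin x).
  by apply: is_derive_eq; rewrite deriv_primitive mulrN opprK.
rewrite (integral_FTC _ _ _ _ (pi_gt0 R) _ dF).
  by rewrite /F !fctE /= cos0 cospi /lint; congr (_%:E); ring.
move=> x; apply: cvgM; last exact: continuous_sin.
by apply: continuous_comp; [exact: continuous_cos | exact: continuous_horner].
Qed.

(** [K z] and [S z] are antiderivatives of cos(z x) and sin(z x), with the frequency 0 treated
    apart. *)
Let K (z x : R) : R := (if z == 0 then x else sin (z * x) / z)%R.
Let S (z x : R) : R := (if z == 0 then 0 else - cos (z * x) / z)%R.

Lemma is_derive_K (z x : R) : is_derive x 1 (K z) (cos (z * x)).
Proof.
rewrite /K; case: eqP => [->|/eqP z0].
  by rewrite mul0r cos0; exact: is_derive_id.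
have -> : (fun x => sin (z * x) / z)%R = z^-1 *: (sin \o (fun x => z * x)%R).
  by apply/funext => y; rewrite /= mulrC.
apply: is_derive_eq.
by rewrite /GRing.scale /= mulr1 mulrCA mulVf ?mulr1.
Qed.

Lemma is_derive_S (z x : R) : is_derive x 1 (S z) (sin (z * x)).
Proof.
rewrite /S; case: eqP => [->|/eqP z0].
  by rewrite mul0r sin0; exact: is_derive_cst.
have -> : (fun x => - cos (z * x) / z)%R = (- z^-1) *: (cos \o (fun x => z * x)%R).
  by apply/funext => y; rewrite /= mulrC mulrN -mulNr.
apply: is_derive_eq.
rewrite /GRing.scale /=. by field.
Qed.

(** The antiderivatives of the sines are even and contribute 0; a cosine contributes 2 sin(z pi) / z
    = 0 unless z = 0, when it is the constant 1. *)
Lemma integral_circle (c1 c2 c3 c4 z1 z2 : R) : sin (z1 * pi) = 0%R -> sin (z2 * pi) = 0%R ->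
  (\int[lam]_(x in `](- pi)%R, pi]) (c1 * cos (z1 * x) + c2 * cos (z2 * x)
     + (c3 * sin (z1 * x) + c4 * sin (z2 * x)))%:E
  = (2 * pi * (c1 * (z1 == 0)%:R + c2 * (z2 == 0)%:R))%:E)%E.
Proof.
move=> s1 s2.
have cm (z : R) (f : R -> R) : continuous f -> continuous (fun x : R => f (z * x)).
  move=> cf x; apply: continuous_comp; last exact: cf.
  exact: mulrl_continuous.
have cc : continuous (fun x : R => c1 * cos (z1 * x) + c2 * cos (z2 * x)
     + (c3 * sin (z1 * x) + c4 * sin (z2 * x)))%R.
  have cMc (c : R) (f : R -> R) : continuous f -> continuous (fun x : R => c * f x).
    by move=> cf x; apply: cvgM; [exact: cvg_cst | exact: cf].
  move=> x; apply: cvgD; apply: cvgD; apply: (cMc); apply: cm;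
    first [exact: continuous_cos | exact: continuous_sin].
rewrite integral_itv_obnd_cbnd; last first.
  by apply/measurable_EFinP; apply: measurable_funTS; exact: continuous_measurable_fun.
pose F : R -> R := c1 *: K z1 + c2 *: K z2 + (c3 *: S z1 + c4 *: S z2).
have dF (x : R) : is_derive x 1 F (c1 * cos (z1 * x) + c2 * cos (z2 * x)
     + (c3 * sin (z1 * x) + c4 * sin (z2 * x))).
  have dK c z := is_deriveZ c (is_derive_K z x).
  have dS c z := is_deriveZ c (is_derive_S z x).
  exact: (is_deriveD (is_deriveD (dK c1 z1) (dK c2 z2)) (is_deriveD (dS c3 z1) (dS c4 z2))).
have pp : - pi < pi :> R by rewrite gtrN // pi_gt0.
rewrite (integral_FTC _ _ _ _ pp cc dF) /F !fctE /K /S !mulrN !sinN !cosN s1 s2.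
by congr (_%:E); do 2 case: eqP => _;
  rewrite ?mulr0n ?mulr1n; rewrite ?oppr0 ?mul0r ?scaler0 /GRing.scale /=; ring.
Qed.

Lemma sin_nat_pi n : sin (n%:R * pi) = 0 :> R.
Proof.
elim: n => [|n IH]; first by rewrite mul0r sin0.
by rewrite -natr1 mulrDl mul1r sinD IH sinpi mul0r mulr0 addr0.
Qed.
End OneDim.

(** * Spherical harmonics *)

Section Indices.
Local Open Scope nat_scope.

(** [hdeg] is the integer square root: some m brackets i between consecutive squares, and any such m
    is the maximum. *)
Lemma hdeg_eq n i : (hdeg i == n) = (n * n <= i < n.+1 * n.+1).
Proof.
suff H m : m * m <= i < m.+1 * m.+1 -> hdeg i = m.
  apply/eqP/idP; last exact: H.
  have [m mP] : exists m, m * m <= i < m.+1 * m.+1.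
    elim: i {H} => [|i [m mP]]; first by exists 0.
    have [lt|ge] := ltnP i.+1 (m.+1 * m.+1); first by exists m; lia.
    by exists m.+1; lia.
  by rewrite (H m mP) => <-.
move=> /andP[mi im]; apply/eqP; rewrite eqn_leq; apply/andP; split.
  apply/bigmax_leqP => j jj; rewrite -ltnS ltnNge; apply/negP => mj.
  by have := leq_mul mj mj; lia.
have mi' : m < i.+1 by nia.
exact: (leq_bigmax_cond (Ordinal mi')).
Qed.

Lemma hdeg_bounds i : hdeg i * hdeg i <= i < (hdeg i).+1 * (hdeg i).+1.
Proof. by rewrite -hdeg_eq. Qed.

Lemma hord_le i : `|hord i| <= hdeg i.
Proof. by have := hdeg_bounds i; rewrite /hord; lia. Qed.

Lemma hdeg_hord_inj i j : hdeg i = hdeg j -> hord i = hord j -> i = j.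
Proof. by rewrite /hord => ->; lia. Qed.

Lemma hord_add n j : j < 2 * n + 1 -> hdeg (n * n + j) = n /\ hord (n * n + j) = (j%:Z - n%:Z)%R.
Proof.
move=> jn; have h : hdeg (n * n + j) = n by apply/eqP; rewrite hdeg_eq; lia.
by split=> //; rewrite /hord h; lia.
Qed.

End Indices.

Lemma sum_hdeg (V : nmodType) (d n : nat) (F : nat -> V) : (n <= d)%N ->
  \sum_(i < d.+1 ^ 2 | hdeg i == n) F i = \sum_(j < 2 * n + 1) F (n * n + j)%N.
Proof.
move=> nd.
have e1 : (n * n <= n.+1 * n.+1)%N by nia.
have e2 : (n.+1 * n.+1 <= d.+1 ^ 2)%N by rewrite -mulnn leq_mul.
rewrite -(big_mkord (fun i => hdeg i == n) F) (big_cat_nat _ (n := n * n)%N) //=;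
  last exact: leq_trans e2.
rewrite [X in _ + X](big_cat_nat _ (n := n.+1 * n.+1)%N) //=.
rewrite big_nat_cond big_pred0 ?add0r; last by move=> i; rewrite hdeg_eq; lia.
rewrite addrC big_nat_cond big_pred0 ?add0r; last by move=> i; rewrite hdeg_eq; lia.
rewrite big_nat_cond (eq_bigl (fun i => (n * n <= i < n.+1 * n.+1)%N && true)); last first.
  by move=> i; rewrite hdeg_eq andbT andbb.
rewrite -big_nat_cond -{1}[(n * n)%N]add0n big_addn big_mkord.
have -> : (n.+1 * n.+1 - n * n = 2 * n + 1)%N by lia.
by apply: eq_bigr => i _; rewrite addnC.
Qed.

(** Pairs each order with its opposite, so that cos^2 + sin^2 = 1 applies. *)
Lemma sum_sym (V : nmodType) (n : nat) (G : int -> V) :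
  \sum_(j < 2 * n + 1) G (j%:Z - n%:Z) = G 0 + \sum_(a < n) (G a.+1%:Z + G (- a.+1%:Z)).
Proof.
have -> : (2 * n + 1 = n + n.+1)%N by lia.
rewrite big_split_ord /= big_ord_recl /= addn0 subrr addrCA; congr (_ + _).
rewrite big_split /= addrC; congr (_ + _).
  by apply: eq_bigr => i _; rewrite /bump /=; congr G; lia.
rewrite (reindex_inj rev_ord_inj) /=.
by apply: eq_bigr => i _; congr G; have := ltn_ord i; lia.
Qed.

Section SphericalHarmonics.
Variable R : realType.

(** The factor 2 of the nonzero orders is moved into [azimuthal], so that one formula covers all
    orders. *)
Definition polar (n a : nat) (x : R) : R :=
  Num.sqrt ((2 * n + 1)%:R * ((n - a)`!%:R / (n + a)`!%:R)) * assoc_legendre n a (cos x).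

Definition azimuthal (m : int) (y : R) : R :=
  if m == 0 then 1 else
    Num.sqrt 2 * (if (0 < m)%R then cos (`|m|%N%:R * y) else sin (`|m|%N%:R * y)).

Lemma sph_harm_split n m (t : R * R) :
  sph_harm n m t = polar n `|m|%N t.1 * azimuthal m t.2.
Proof.
rewrite /sph_harm /polar /azimuthal; case: eqP => [->|_].
  rewrite absz0 subn0 addn0 divff ?pnatr_eq0 -?lt0n ?fact_gt0 // !mulr1.
  by rewrite /assoc_legendre !expr0 !mul1r derivn0.
have -> : 2 * (2 * n + 1)%:R * (n - `|m|)`!%:R / (n + `|m|)`!%:R =
   2 * ((2 * n + 1)%:R * ((n - `|m|)`!%:R / (n + `|m|)`!%:R)) :> R by rewrite !mulrA.
by rewrite sqrtrM //; ring.
Qed.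

(** For a common order the signs cancel and the roots pair up, leaving a polynomial in cos x. *)
Lemma polar_mul n l a (x : R) : polar n a x * polar l a x =
  Num.sqrt ((2 * n + 1)%:R * ((n - a)`!%:R / (n + a)`!%:R)) *
  Num.sqrt ((2 * l + 1)%:R * ((l - a)`!%:R / (l + a)`!%:R)) *
  ((1 - 'X ^+ 2) ^+ a * (legendre R n)^`(a) * (legendre R l)^`(a)).[cos x].
Proof.
rewrite /polar /assoc_legendre !hornerM horner_exp !hornerE /=.
have s : 0 <= 1 - cos x ^+ 2 by rewrite -sin2cos2 sqr_ge0.
have -> : (1 - cos x ^+ 2) ^+ a = Num.sqrt (1 - cos x ^+ 2) ^+ a * Num.sqrt (1 - cos x ^+ 2) ^+ a.
  by rewrite -exprMn -expr2 sqr_sqrtr.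
have e1 : (-1) ^+ a * (-1) ^+ a = 1 :> R by rewrite -exprMn mulrNN mulr1 expr1n.
by rewrite -[RHS]mul1r -[X in _ = X * _]e1; ring.
Qed.

Lemma polar_sqr n a (x : R) : polar n a x ^+ 2 = (2 * n + 1)%:R *
  ((n - a)`!%:R / (n + a)`!%:R * ((1 - 'X ^+ 2) ^+ a * (legendre R n)^`(a) ^+ 2).[cos x]).
Proof.
rewrite expr2 polar_mul -expr2 sqr_sqrtr ?mulr_ge0 ?divr_ge0 ?ler0n //.
by rewrite -!mulrA -expr2.
Qed.

Lemma polar_addition n (x : R) :
  polar n 0 x ^+ 2 + 2 * \sum_(a < n) polar n a.+1 x ^+ 2 = (2 * n + 1)%:R.
Proof.
have := congr1 (fun p => (2 * n + 1)%:R * p.[cos x]) (legendre_addition R n).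
rewrite hornerD [X in _ + X]hornerM horner_sum hornerC mulr1 => <-.
rewrite polar_sqr subn0 addn0 divff ?pnatr_eq0 -?lt0n ?fact_gt0 // expr0 !mul1r derivn0.
under eq_bigr do rewrite polar_sqr.
rewrite -mulr_sumr -[RHS]/(_ * _) mulrDr; congr (_ + _).
rewrite -(polyC_natr _ 2) hornerC mulrCA; congr (_ * (_ * _)).
by apply: eq_bigr => i _; rewrite -[in RHS]mulrA [RHS]hornerM hornerC.
Qed.

(** Each square is one of the nonnegative terms of the addition theorem; the resulting bound
    supplies integrability. *)
Lemma polar_sqr_le n a (x : R) : (a <= n)%N -> polar n a x ^+ 2 <= (2 * n + 1)%:R.
Proof.
rewrite -(polar_addition n x); case: a => [|a] an.
  by rewrite lerDl mulr_ge0 // sumr_ge0 // => i _; exact: sqr_ge0.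
rewrite (bigD1 (Ordinal an)) //= mulrDr.
have := sqr_ge0 (polar n 0 x); have := sqr_ge0 (polar n a.+1 x).
have : 0 <= \sum_(i < n | i != Ordinal an) polar n i.+1 x ^+ 2.
  by apply: sumr_ge0 => i _; exact: sqr_ge0.
move: (\sum_(_ < _ | _) _) (_ ^+ 2) (_ ^+ 2) => u v w; lra.
Qed.

Lemma polar_bound n a (x : R) : (a <= n)%N -> `|polar n a x| <= (2 * n + 1)%:R.
Proof.
move=> an; rewrite -ler_sqr ?nnegrE ?normr_ge0 ?ler0n // real_normK ?num_real //.
apply: le_trans (polar_sqr_le _ _ x an) _.
by rewrite -natrX ler_nat -mulnn leq_pmulr // addn1.
Qed.

Lemma azimuthal_bound m (y : R) : `|azimuthal m y| <= 2.
Proof.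
rewrite /azimuthal; case: eqP => _; first by rewrite normr1 ler1n.
rewrite normrM ger0_norm ?sqrtr_ge0 //.
have s2 : Num.sqrt 2 <= 2 :> R.
  by rewrite -[X in _ <= X](ger0_norm (ler0n _ 2)) -sqrtr_sqr ler_sqrt ?sqr_ge0 // -natrX ler_nat.
rewrite -[X in _ <= X]mulr1 ler_pM ?sqrtr_ge0 //.
by case: ifP => _; rewrite ler_norml ?cos_geN1 ?cos_le1 ?sin_geN1 ?sin_le1.
Qed.

Lemma azimuthal_pair a (y : R) :
  azimuthal a.+1%:Z y ^+ 2 + azimuthal (- a.+1%:Z) y ^+ 2 = 2.
Proof.
rewrite /azimuthal /= !exprMn sqr_sqrtr // -mulrDr cos2Dsin2 mulr1 //.
Qed.

Lemma sum_sph_harm_sqr n d (t : R * R) : (n <= d)%N ->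
  \sum_(i < d.+1 ^ 2 | hdeg i == n) sph_harm (hdeg i) (hord i) t ^+ 2 = (2 * n + 1)%:R.
Proof.
move=> nd; rewrite (sum_hdeg _ _ _ (fun i => sph_harm (hdeg i) (hord i) t ^+ 2) nd).
transitivity (\sum_(j < 2 * n + 1) sph_harm n (j%:Z - n%:Z) t ^+ 2).
  by apply: eq_bigr => j _; have [-> ->] := hord_add _ _ (ltn_ord j).
rewrite (sum_sym _ _ (fun m => sph_harm n m t ^+ 2)) -(polar_addition n t.1).
rewrite sph_harm_split {1}/azimuthal eqxx mulr1; congr (_ + _).
rewrite mulr_sumr; apply: eq_bigr => a _.
have E m : sph_harm n m t ^+ 2 = polar n `|m|%N t.1 ^+ 2 * azimuthal m t.2 ^+ 2
  by rewrite sph_harm_split exprMn.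
by rewrite !E abszN -mulrDr azimuthal_pair mulrC.
Qed.

Lemma continuous_assoc_legendre n a : continuous (@assoc_legendre R n a).
Proof.
move=> x; apply: cvgM; last exact: continuous_horner.
apply: cvgM; first exact: cvg_cst.
apply: (@continuous_comp R R R (fun z => Num.sqrt (1 - z ^+ 2)) (fun u => u ^+ a));
  last exact: exprn_continuous.
apply: (@continuous_comp R R R (fun z : R => 1 - z ^+ 2) Num.sqrt); last exact: sqrt_continuous.
by apply: cvgB; [exact: cvg_cst | exact: exprn_continuous].
Qed.

Lemma continuous_polar n a : continuous (polar n a).
Proof.
move=> x; apply: cvgM; first exact: cvg_cst.
apply: (@continuous_comp R R R (@cos R) (@assoc_legendre R n a)); first exact: continuous_cos.
exact: continuous_assoc_legendre.
Qed.

Lemma continuous_azimuthal m : continuous (azimuthal m : R -> R).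
Proof.
rewrite /azimuthal; case: eqP => _ x; first exact: cvg_cst.
apply: cvgM; first exact: cvg_cst.
by case: ifP => _; apply: continuous_comp; try exact: mulrl_continuous;
  [exact: continuous_cos | exact: continuous_sin].
Qed.

End SphericalHarmonics.

(** * Orthonormality and information matrices *)

Section Orthonormality.
Variable R : realType.
Local Notation lam := (@lebesgue_measure R).

Lemma integral_azimuthal m m' :
  (\int[lam]_(y in `](- pi)%R, pi]) (azimuthal R m y * azimuthal R m' y)%:E =
   (2 * pi * (m == m')%:R)%:E)%E.
Proof.
(* Cosine and sine coefficients in a uniform expression for all signs of k; the product-to-sum
   formulas then yield [c1] to [c4]. *)
pose al (k : int) : R := if k == 0 then 1 else if (0 < k)%R then Num.sqrt 2 else 0.
pose be (k : int) : R := if (k < 0)%R then Num.sqrt 2 else 0.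
have azE (k : int) y : azimuthal R k y = al k * cos (`|k|%N%:R * y) + be k * sin (`|k|%N%:R * y).
  rewrite /azimuthal /al /be; case: ltgtP => k0; rewrite ?mul0r ?add0r ?addr0 //.
  by rewrite -k0 absz0 mul0r cos0 mulr1.
pose a : R := `|m|%N%:R; pose b : R := `|m'|%N%:R.
have s1 : sin ((a - b) * pi) = 0 by rewrite mulrBl sinB !sin_nat_pi mulr0 mul0r subrr.
have s2 : sin ((a + b) * pi) = 0 by rewrite mulrDl sinD !sin_nat_pi mulr0 mul0r addr0.
pose c1 := (al m * al m' + be m * be m') / 2; pose c2 := (al m * al m' - be m * be m') / 2.
pose c3 := (be m * al m' - al m * be m') / 2; pose c4 := (be m * al m' + al m * be m') / 2.
transitivity (\int[lam]_(y in `](- pi)%R, pi]) (c1 * cos ((a - b) * y) + c2 * cos ((a + b) * y)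
     + (c3 * sin ((a - b) * y) + c4 * sin ((a + b) * y)))%:E)%E.
  apply: eq_integral => y _; congr (_%:E).
  rewrite !azE -/a -/b [(a - b) * y]mulrBl [(a + b) * y]mulrDl cosB cosD sinB sinD /c1 /c2 /c3 /c4.
  by field.
rewrite integral_circle //.
congr (_ * _)%:E.
have -> : (a - b == 0) = (`|m| == `|m'|)%N by rewrite subr_eq0 /a /b eqr_nat.
have -> : (a + b == 0) = (m == 0) && (m' == 0).
  by rewrite /a /b -natrD pnatr_eq0 addn_eq0 !absz_eq0.
have r2 : Num.sqrt 2 * Num.sqrt 2 = 2 :> R by rewrite -expr2 sqr_sqrtr.
rewrite /c1 /c2 /al /be.
case: (ltgtP m 0) => m0; case: (ltgtP m' 0) => m'0 /=;
  rewrite ?mulr0 ?mul0r ?mulr1 ?add0r ?addr0 ?r2 ?divff //.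
all: try by case: (eqVneq m m') => [|/eqP] e; case: (eqVneq `|m|%N `|m'|%N) => [|/eqP] e' //=;
  rewrite ?mul0r ?mulr1 ?mulr0 //; lia.
by rewrite m0 m'0 !eqxx subr0 /=; field.
Qed.

Lemma integral_polar n l a :
  (\int[lam]_(x in `[0%R, pi]) (polar R n a x * polar R l a x * (sin x / (4 * pi)))%:E =
  (Num.sqrt ((2 * n + 1)%:R * ((n - a)`!%:R / (n + a)`!%:R)) *
  Num.sqrt ((2 * l + 1)%:R * ((l - a)`!%:R / (l + a)`!%:R)) / (4 * pi) * Lprod R a n l)%:E)%E.
Proof.
set c := Num.sqrt _ * Num.sqrt _ / _.
rewrite /Lprod -lintZ -integral_horner_cos; apply: eq_integral => x _.
by rewrite polar_mul hornerZ /c; congr (_%:E); ring.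
Qed.

Lemma measurable_polar n a : measurable_fun setT (polar R n a).
Proof. by apply: continuous_measurable_fun; exact: continuous_polar. Qed.

Lemma measurable_azimuthal m : measurable_fun setT (azimuthal R m).
Proof. by apply: continuous_measurable_fun; exact: continuous_azimuthal. Qed.

Lemma measurable_sph_harm n m : measurable_fun setT (fun t : (R * R)%type => sph_harm n m t).
Proof.
rewrite (_ : (fun t => _) =
  (fun t : (R * R)%type => polar R n `|m|%N t.1 * azimuthal R m t.2)); last first.
  by apply/funext => t; exact: sph_harm_split.
apply: measurable_funM.
- by apply: (measurableT_comp (measurable_polar n `|m|%N)); exact: measurable_fst.
- by apply: (measurableT_comp (measurable_azimuthal m)); exact: measurable_snd.
Qed.

Lemma sph_harm_bound n m (t : R * R) : (`|m| <= n)%N -> `|sph_harm n m t| <= (2 * n + 1)%:R * 2.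
Proof.
by move=> mn; rewrite sph_harm_split normrM ler_pM //; [exact: polar_bound | exact: azimuthal_bound].
Qed.

Lemma sph_harm_orthonormal (xi : probability (R * R)%type R) n l m m' :
  is_uniform_sphere xi -> (`|m| <= n)%N -> (`|m'| <= l)%N ->
  Rintegral xi (@dspace R) (fun t => sph_harm n m t * sph_harm l m' t) = ((n == l) && (m == m'))%:R.
Proof.
move=> xiU mn ml; rewrite /Rintegral.
rewrite (integral_uniform_sphere _ xi (fun t => sph_harm n m t * sph_harm l m' t)) //; first last.
- exists ((2 * n + 1)%:R * 2 * ((2 * l + 1)%:R * 2)) => t.
  by rewrite normrM ler_pM // sph_harm_bound.
- by apply: measurable_funM; exact: measurable_sph_harm.
pose g (x : R) := polar R n `|m|%N x * polar R l `|m'|%N x * (sin x / (4 * pi)).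
pose h (y : R) := azimuthal R m y * azimuthal R m' y.
transitivity (fine (\int[leb2 R]_(t in @dspace R) (g t.1 * h t.2)%:E)).
  congr fine; apply: eq_integral => t _.
  by rewrite !sph_harm_split /g /h; congr (_%:E); ring.
rewrite (integral_leb2_prod R g h ((2 * n + 1)%:R * (2 * l + 1)%:R * (4 * pi)^-1) (2 * 2));
  first last.
- by move=> y; rewrite /h normrM ler_pM // azimuthal_bound.
- have p0 : 0 <= (4 * pi)^-1 :> R by rewrite invr_ge0 mulr_ge0 ?pi_ge0.
  move=> x; rewrite /g normrM (normrM (polar _ _ _ _)) (normrM (sin x)) (ger0_norm p0)
    ler_pM ?mulr_ge0 //.
    by rewrite ler_pM // polar_bound.
  by rewrite ler_piMl // ler_norml sin_geN1 sin_le1.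
- by apply: measurable_funM; exact: measurable_azimuthal.
- apply: measurable_funM; first by apply: measurable_funM; exact: measurable_polar.
  apply: measurable_funM => //.
  by apply: continuous_measurable_fun; exact: continuous_sin.
(* Distinct orders already vanish over the circle, so the polar factors are compared only at a
   common order. *)
rewrite integral_azimuthal; case: (eqVneq m m') => [mm|_]; last by rewrite mulr0 mule0 andbF.
rewrite /g -mm in ml *; rewrite integral_polar andbT mulr1 /=.
have pi0 : pi != 0 :> R by rewrite gt_eqF // pi_gt0.
have [<-|nl] := eqVneq n l; last by rewrite Lprod_neq // mulr0 mul0r.
rewrite -expr2 sqr_sqrtr ?mulr_ge0 ?divr_ge0 ?ler0n //.
have := Lprod_diag R _ _ mn; set q := _ * (_ / _) => H.
(* The circle contributes 2 pi against the constant 1/(4 pi), which leaves half of the value 2 of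
   [Lprod_diag]. *)
transitivity (q * Lprod R `|m| n n / 2); last by rewrite H divff.
have E (u v w : R) : w != 0 -> u / (4 * w) * v * (2 * w) = u * v / 2 by move=> w0; field.
exact: E.
Qed.

End Orthonormality.

(** * Information matrices as Gram matrices *)

Section Designs.
Variables (R : realType) (d : nat) (xi : probability (R * R)%type R).

Lemma measurable_dspace_default : measurable (@dspace R : set (R * R)%type).
Proof. exact: measurable_dspace. Qed.

Lemma fvecE i (t : R * R) : fvec d t i ord0 = sph_harm (hdeg i) (hord i) t.
Proof. by rewrite mxE. Qed.

Lemma integrable_fvec_mul i j :
  xi.-integrable (@dspace R) (EFin \o (fun t => fvec d t i ord0 * fvec d t j ord0)).
Proof.
apply: (integrable_bounded _ _ _ ((2 * hdeg i + 1)%:R * 2 * ((2 * hdeg j + 1)%:R * 2))).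
- exact: measurable_dspace_default.
- by rewrite (le_lt_trans (probability_le1 _ _)) ?ltry //; exact: measurable_dspace_default.
- apply: measurable_funM; under eq_fun do rewrite fvecE; exact: measurable_sph_harm.
- by move=> t; rewrite !fvecE normrM ler_pM // sph_harm_bound // hord_le.
Qed.

(** Integrability is carried along because the induction step for the value uses it. *)
Lemma Rintegral_sum_seq (I : Type) (r : seq I) (F : I -> (R * R)%type -> R) :
  (forall i, xi.-integrable (@dspace R) (EFin \o F i)) ->
  xi.-integrable (@dspace R) (EFin \o (fun t => \sum_(i <- r) F i t)) /\
  Rintegral xi (@dspace R) (fun t => \sum_(i <- r) F i t) =
  \sum_(i <- r) Rintegral xi (@dspace R) (F i).
Proof.
move=> iF; have mD := measurable_dspace_default.
elim: r => [|i r [ih1 ih2]].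
  rewrite big_nil (_ : (fun t => _) = cst 0); last by apply/funext => t; rewrite big_nil.
  split; first exact: finite_measure_integrable_cst.
  by rewrite Rintegral_cst ?mul0r.
rewrite big_cons -ih2 (_ : (fun t => _) = (F i \+ (fun t => \sum_(i <- r) F i t))); last first.
  by apply/funext => t; rewrite big_cons.
by split; [exact: (integrableD mD (iF i) ih1) | exact: (RintegralD mD (iF i) ih1)].
Qed.

(** Exhibits the form as the integral of a square, hence its nonnegativity. *)
Lemma quad_info_mx (v : 'rV[R]_(d.+1 ^ 2)) :
  quad _ (info_mx d xi) v =
  Rintegral xi (@dspace R) (fun t => (\sum_i v 0 i * fvec d t i ord0) ^+ 2).
Proof.
have mD := measurable_dspace_default.
have iF i j c : xi.-integrable (@dspace R)
    (EFin \o (fun t => c * (fvec d t i ord0 * fvec d t j ord0))).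
  by apply: (integrableZl mD c (integrable_fvec_mul i j)).
transitivity (\sum_j \sum_i Rintegral xi (@dspace R)
  (fun t => v 0 i * v 0 j * (fvec d t i ord0 * fvec d t j ord0))).
  rewrite /quad mxE; apply: eq_bigr => j _; rewrite !mxE mulr_suml; apply: eq_bigr => i _.
  by rewrite RintegralZl ?integrable_fvec_mul // mxE; ring.
under eq_bigr => j _ do rewrite -(Rintegral_sum_seq _ _ _ (fun i => iF i j _)).2.
rewrite -(Rintegral_sum_seq _ _ _ (fun j => (Rintegral_sum_seq _ _ _ (fun i => iF i j _)).1)).2.
congr (Rintegral _ _ _); apply/funext => t.
rewrite expr2 mulr_sumr; apply: eq_bigr => j _; rewrite mulr_suml; apply: eq_bigr => i _; ring.
Qed.

Lemma possemidef_info_mx : possemidef _ (info_mx d xi).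
Proof.
split=> [|v]; last by rewrite quad_info_mx Rintegral_ge0 // => t _; exact: sqr_ge0.
apply/matrixP => i j; rewrite !mxE; congr (Rintegral _ _ _).
by apply/funext => t; rewrite mulrC.
Qed.

End Designs.

(** * Optimality *)

Section Selection.
Variables (R : realType) (d q : nat) (k : 'I_q.+1 -> nat).
Hypothesis kd : forall l, (k l <= d)%N.
Local Notation S := (@sel_set d q k).
Local Notation K := (sel_mx R d k).

Lemma sel_mxTK : K^T *m K = 1%:M.
Proof.
apply/matrixP => a b; rewrite !mxE (bigD1 (enum_val a)) //= !mxE eqxx mul1r (inj_eq enum_val_inj).
by rewrite big1 ?addr0 // => i /negPf ia; rewrite !mxE ia mul0r.
Qed.

Lemma tr_sel_mx (M : 'M[R]_(d.+1 ^ 2)) : \tr (K^T *m M *m K) = \sum_(i in S) M i i.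
Proof.
rewrite big_enum_val; apply: eq_bigr => a _.
rewrite mxE (bigD1 (enum_val a)) //= [K _ _]mxE eqxx mulr1 [X in _ + X]big1 ?addr0; last first.
  by move=> i /negPf ia; rewrite [K _ _]mxE ia mulr0.
rewrite mxE (bigD1 (enum_val a)) //= !mxE eqxx mul1r big1 ?addr0 //.
by move=> i /negPf ia; rewrite !mxE ia mul0r.
Qed.

Lemma card_sel_set_gt0 : (0 < #|S|)%N.
Proof.
(* The witness is the first index of the degree block of [k ord0]. *)
have lt : (k ord0 * k ord0 < d.+1 ^ 2)%N by have := kd ord0; rewrite -mulnn; nia.
apply/card_gt0P; exists (Ordinal lt); rewrite inE; apply/existsP; exists ord0.
have [|h _] := hord_add (k ord0) 0; first by rewrite addn1.
by move: h; rewrite addn0 /= => ->.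
Qed.

Lemma hdeg_le (i : 'I_(d.+1 ^ 2)) : (hdeg i <= d)%N.
Proof.
have lt : (i < d.+1 * d.+1)%N by rewrite mulnn.
have /andP[h _] := hdeg_bounds i.
by rewrite leqNgt; apply/negP => dh; have := leq_mul dh dh; lia.
Qed.

(** The selection is a union of whole degree blocks, each taken once, so sums may be compared block
    by block. *)
Lemma eq_sum_sel_set (V : nmodType) (F G : nat -> V) :
  (forall n, (n <= d)%N ->
     \sum_(i < d.+1 ^ 2 | hdeg i == n) F i = \sum_(i < d.+1 ^ 2 | hdeg i == n) G i) ->
  \sum_(i in S) F i = \sum_(i in S) G i.
Proof.
move=> FG.
have part (H : nat -> V) : \sum_(i in S) H i =
    \sum_(n < d.+1 | [exists l, val n == k l]) \sum_(i < d.+1 ^ 2 | hdeg i == n) H i.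
  rewrite (partition_big (fun i : 'I_(d.+1 ^ 2) => inord (hdeg i) : 'I_d.+1)
     (fun n => [exists l, val n == k l])) /=; last first.
    by move=> i; rewrite inE inordK // ltnS hdeg_le.
  apply: eq_bigr => n nk; apply: eq_bigl => i.
  rewrite inE -val_eqE /= inordK ?ltnS ?hdeg_le //.
  by case: (eqVneq (hdeg i) n) => [->|_]; rewrite ?andbF // nk.
by rewrite !part; apply: eq_bigr => n _; apply: FG; rewrite -ltnS.
Qed.

Lemma sum_sel_set_sqr (t : R * R) : \sum_(i in S) fvec d t i ord0 * fvec d t i ord0 = #|S|%:R.
Proof.
under eq_bigr do rewrite fvecE -expr2.
rewrite -sumr_const.
(* Over a block of degree n, both the squares and the constants 1 sum to 2n+1. *)
apply: (eq_sum_sel_set _ (fun i => sph_harm (hdeg i) (hord i) t ^+ 2) (fun=> 1)) => n nd.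
by rewrite (sum_sph_harm_sqr _ _ _ _ nd) (sum_hdeg _ _ _ (fun=> 1) nd) sumr_const card_ord.
Qed.

Lemma tr_sel_info_mx (xi : probability (R * R)%type R) : is_design xi ->
  \tr (K^T *m info_mx d xi *m K) = #|S|%:R.
Proof.
move=> xi1; rewrite tr_sel_mx; under eq_bigr do rewrite mxE.
rewrite -big_enum -(Rintegral_sum_seq _ _ _ _ _ (fun i => integrable_fvec_mul R d xi i i)).2.
under eq_Rintegral do rewrite big_enum sum_sel_set_sqr.
rewrite Rintegral_cst; last exact: (measurable_dspace_default R).
by rewrite [X in _ * X](congr1 fine xi1) mulr1.
Qed.

Lemma CK_sel_mx1 : CK K 1%:M = 1%:M.
Proof.
have p1 : pinvmx (1%:M : 'M[R]_(d.+1 ^ 2)) = 1%:M.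
  (* M M^- M = M at the identity matrix. *)
  by have := mulmxKpV (submx_refl (1%:M : 'M[R]_(d.+1 ^ 2))); rewrite mul1mx mulmx1.
by rewrite /CK p1 mulmx1 sel_mxTK invmx1.
Qed.

Lemma Phi_p_sel_le (p : \bar R) (xi : probability (R * R)%type R) : (p < 1%:E)%E ->
  is_design xi -> estimable K (info_mx d xi) ->
  Phi_p p K (info_mx d xi) <= Phi_p p K 1%:M.
Proof.
move=> p1 xi1 est.
have [Cp Ct] := CK_posdef_trace _ _ _ _ _ (possemidef_info_mx R d xi) est sel_mxTK.
rewrite /Phi_p CK_sel_mx1; apply: Phi_mx_le1 => //; first exact: card_sel_set_gt0.
by rewrite -(tr_sel_info_mx _ xi1).
Qed.

End Selection.

Lemma info_mx_uniform (R : realType) d (xi : probability (R * R)%type R) :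
  is_uniform_sphere xi -> info_mx d xi = 1%:M.
Proof.
move=> xiU; apply/matrixP => i j; rewrite !mxE.
under eq_Rintegral do rewrite !fvecE.
rewrite sph_harm_orthonormal ?hord_le //; congr ((nat_of_bool _)%:R).
apply/idP/eqP => [/andP[/eqP hd /eqP ho]|->]; last by rewrite !eqxx.
exact/val_inj/hdeg_hord_inj.
Qed.

(** Y_0^0 is the constant 1, so its normalisation says that the domain has mass 1. *)
Lemma is_design_uniform (R : realType) (xi : probability (R * R)%type R) :
  is_uniform_sphere xi -> is_design xi.
Proof.
move=> xiU; have mD := measurable_dspace_default R.
have := sph_harm_orthonormal R xi 0 0 0 0 xiU isT isT.
rewrite (_ : (fun t => _) = cst 1); last first.
  apply/funext => t; rewrite sph_harm_split /azimuthal eqxx mulr1 -expr2.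
  by have := polar_addition R 0 t.1; rewrite big_ord0 mulr0 addr0.
rewrite Rintegral_cst // mul1r /= => xi1.
by rewrite /is_design -(@fineK _ (xi (@dspace R))) ?fin_num_measure // xi1.
Qed.

Theorem theorem2p1 (R : realType) (d : nat) (p : \bar R) (q : nat)
    (k : 'I_q.+1 -> nat) :
  (0 < d)%N -> (p < 1%:E)%E ->
  (forall l l' : 'I_q.+1, (l < l')%N -> (k l < k l')%N) ->
  (forall l, (k l <= d)%N) ->
  forall xistar : probability (R * R)%type R,
  is_uniform_sphere xistar ->
  info_mx d xistar = 1%:M /\
  is_design xistar /\
  estimable (sel_mx R d k) (info_mx d xistar) /\
  (forall xi : probability (R * R)%type R,
     is_design xi -> estimable (sel_mx R d k) (info_mx d xi) ->
     Phi_p p (sel_mx R d k) (info_mx d xi) <=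
     Phi_p p (sel_mx R d k) (info_mx d xistar)).
Proof.
move=> _ p1 _ kd xistar xiU.
rewrite (info_mx_uniform R d xistar xiU).
split; first by [].
split; first exact: is_design_uniform.
split; first by rewrite /estimable trmx1 submx1.
by move=> xi xi1 est; exact: Phi_p_sel_le.
Qed.
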